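(* Let $n\ge 3$, $k\in\{2,\ldots,n-1\}$, $T^{k,n}=(N_1,\ldots,N_t)$ the problem instance defined in the context (so $t=\binom{n-1}{k}2^k$), and $1\le s\le t$. Let $N$ be an optimal solution for $T^{k,n}$. Then $f_{T^{k,n}}(N_s)\ge \tfrac{3}{2}\,f_{T^{k,n}}(N)$.
   Context: Binary attributes $V_1,\ldots,V_n$, each with domain $\{0,1\}$. For $Q\subseteq\{V_1,\ldots,V_{n-1}\}$, $\mathrm{Inst}(Q)$ is the set of assignments of values in $\{0,1\}$ to the attributes of $Q$ (contexts). A (complete) CPT $N$ for $V_n$ consists of a parent set $Pa(N,V_n)\subseteq\{V_1,\ldots,V_{n-1}\}$ and, for each $\gamma\in\mathrm{Inst}(Pa(N,V_n))$, exactly one rule, either $\gamma:0\succ 1$ or $\gamma:1\succ 0$. A swap over $V_n$ is identified with an element $x\in\{0,1\}^{n-1}$; the vote of $N$ on $x$ is $0$ if the rule of $N$ whose context agrees with $x$ on $Pa(N,V_n)$ is of the form $\gamma:0\succ1$, and $1$ otherwise. $\Delta(N,N')$ is the number of swaps on which $N,N'$ vote differently. For a problem instance $T=(N_1,\ldots,N_t)$ (tuple of CPTs for $V_n$), $f_T(N)=\sum_{s=1}^t\Delta(N,N_s)$; an optimal solution for $T$ is a CPT for $V_n$ (any parent set $\subseteq\{V_1,\ldots,V_{n-1}\}$) minimizing $f_T$. The instance $T^{k,n}=(N_1,\ldots,N_t)$ has $t=\binom{n-1}{k}2^k$, with the indices $s$ in bijection with the pairs $(P,\gamma)$ where $P$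 is a $k$-element subset of $\{V_1,\ldots,V_{n-1}\}$ and $\gamma\in\mathrm{Inst}(P)$; the CPT $N_s$ corresponding to $(P,\gamma)$ has parent set $P$, the rule $\gamma:1\succ0$, and the rule $\gamma':0\succ1$ for every $\gamma'\in\mathrm{Inst}(P)\setminus\{\gamma\}$. *)

(* Defs.v *)
From HB Require Import structures.
From mathcomp Require Import all_boot all_order all_algebra.

Set Implicit Arguments.
Unset Strict Implicit.
Unset Printing Implicit Defensive.

(* V_1, ..., V_{n-1} are indexed by 'I_n.-1; attribute values 0 and 1 are
   [false] and [true]. *)

Definition Inst (n : nat) (Q : {set 'I_n.-1}) : finType :=
  {ffun {i : 'I_n.-1 | i \in Q} -> bool}.

Inductive pref := Pref01 (* 0 > 1 *) | Pref10 (* 1 > 0 *).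

Record cpt (n : nat) := Cpt {
  Pa : {set 'I_n.-1};
  rule : Inst Pa -> pref
}.

Definition swap (n : nat) : finType := {ffun 'I_n.-1 -> bool}.

Definition restr (n : nat) (Q : {set 'I_n.-1}) (x : swap n) : Inst Q :=
  [ffun i : {i : 'I_n.-1 | i \in Q} => x (val i)].

Definition vote (n : nat) (N : cpt n) (x : swap n) : bool :=
  if rule (restr (Pa N) x) is Pref01 then false else true.

Definition Delta (n : nat) (N N' : cpt n) : nat :=
  #|[set x : swap n | vote N x != vote N' x]|.

Definition f (n t : nat) (T : t.-tuple (cpt n)) (N : cpt n) : nat :=
  \sum_(s < t) Delta N (tnth T s).

Definition optimal (n t : nat) (T : t.-tuple (cpt n)) (N : cpt n) : Prop :=
  forall N' : cpt n, f T N <= f T N'.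

Definition ksubset (n k : nat) : finType := {P : {set 'I_n.-1} | #|P| == k}.

Definition kcontext (n k : nat) : finType := {P : ksubset n k & Inst (val P)}.

Definition single_cpt (n : nat) (P : {set 'I_n.-1}) (g : Inst P) : cpt n :=
  @Cpt n P (fun g' => if g' == g then Pref10 else Pref01).

Definition Tsize (n k : nat) : nat := 'C(n.-1, k) * 2 ^ k.

(* The instance T^{k,n}, for an arbitrary indexing [e] of the pairs (P, gamma);
   [e] is meant to be a bijection. *)
Definition Tkn (n k : nat) (e : 'I_(Tsize n k) -> kcontext n k) :
    (Tsize n k).-tuple (cpt n) :=
  [tuple single_cpt (tagged (e s)) | s < Tsize n k].

Lemma card_kcontext (n k : nat) : #|kcontext n k| = Tsize n k.
Proof.
rewrite card_tagged sumnE big_map big_enum /=.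
rewrite (eq_bigr (fun=> 2 ^ k)) => [|P _].
  rewrite sum_nat_const /Tsize card_sig -cardsE.
  by rewrite -[in RHS](card_ord n.-1) -card_draws.
by rewrite card_ffun card_bool card_sig (eqP (valP P)).
Qed.

Lemma kcontext_indexing (n k : nat) :
  exists e : 'I_(Tsize n k) -> kcontext n k, bijective e.
Proof.
by rewrite -card_kcontext; exists enum_val; exact: enum_val_bij.
Qed.

(* Main.v *)
Require Import Defs.
From mathcomp Require Import all_boot all_order all_algebra.
From mathcomp Require Import zify.
Import Order.TTheory GRing.Theory Num.Theory.
Local Open Scope ring_scope.

(** Put m = n - 1 and C = 'C(m, k).  On every swap exactly C of the C * 2 ^ k
    input CPTs vote 1, so f(N) = C * 2 ^ m + a * C * (2 ^ k - 2), where a is the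
    number of swaps on which N votes 1.  The CPT that always votes 0 shows that
    the optimum is at most C * 2 ^ m, whereas a = 2 ^ (m - k) for each input CPT;
    the claim then reduces to 2 ^ k >= 4. *)

Lemma card_ksubset (n k : nat) : #|ksubset n k| = 'C(n.-1, k).
Proof. by rewrite card_sig -cardsE card_draws card_ord. Qed.

Lemma vote_single_cpt (n : nat) (P : {set 'I_n.-1}) (g : Inst P) (x : swap n) :
  vote (single_cpt g) x = (restr P x == g).
Proof. by rewrite /vote /=; case: (_ == _). Qed.

(** For each [k]-subset [P] exactly one context agrees with [x], namely [restr P x]; thus [h] puts
    the [k]-subsets in bijection with the pairs voting 1. *)
Lemma card_votes1 (n k : nat) (x : swap n) :
  #|[set c : kcontext n k | vote (single_cpt (tagged c)) x]| = 'C(n.-1, k).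
Proof.
pose h (P : ksubset n k) : kcontext n k :=
  Tagged (fun P : ksubset n k => Inst (val P)) (restr (val P) x).
have h_inj : injective h by move=> P Q [].
rewrite -card_ksubset -(card_imset predT h_inj); apply: eq_card => -[P g].
rewrite !inE vote_single_cpt; apply/eqP/imsetP => [/= gE|[Q _ ->]] //.
by exists P; rewrite // /h gE.
Qed.

Lemma card_votes0 (n k : nat) (x : swap n) :
  #|[set c : kcontext n k | ~~ vote (single_cpt (tagged c)) x]|
  = ('C(n.-1, k) * (2 ^ k).-1)%N.
Proof.
have := cardsC [set c : kcontext n k | vote (single_cpt (tagged c)) x].
rewrite card_votes1 card_kcontext /Tsize => h.
rewrite -[(2 ^ k).-1]subn1 mulnBr muln1 -h addKn.
by apply: eq_card => c; rewrite !inE.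
Qed.

Lemma tnth_Tkn (n k : nat) (e : 'I_(Tsize n k) -> kcontext n k) s :
  tnth (Tkn e) s = single_cpt (tagged (e s)).
Proof. exact: tnth_mktuple. Qed.

(** Double counting: exchanging the sums counts, swap by swap, the input CPTs that disagree with
    [N], and bijectivity of [e] turns indices into pairs. *)
Lemma f_TknE (n k : nat) (e : 'I_(Tsize n k) -> kcontext n k) (N : cpt n) :
  bijective e ->
  f (Tkn e) N =
  (\sum_(x : swap n)
     (if vote N x then 'C(n.-1, k) * (2 ^ k).-1 else 'C(n.-1, k)))%N.
Proof.
move=> e_bij; rewrite /f.
under [LHS]eq_bigr do rewrite tnth_Tkn /Delta -sum1dep_card big_mkcond.
rewrite exchange_big; apply: eq_bigr => x _ /=.
rewrite -(reindex e (P := predT)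
  (F := fun c => if vote N x != vote (single_cpt (tagged c)) x then 1%N else 0%N));
  last exact: onW_bij.
rewrite -big_mkcond /= sum1dep_card.
case: (vote N x); [rewrite -(card_votes0 n k x) | rewrite -(card_votes1 n k x)];
  by apply: eq_card => c; rewrite !inE; case: (vote _ _).
Qed.

(** The fiber is a product over coordinates: those in [P] are forced by [g], and each of the others
    contributes a factor 2. *)
Lemma card_restr_fiber (n : nat) (P : {set 'I_n.-1}) (g : Inst P) :
  #|[set x : swap n | restr P x == g]| = (2 ^ (n.-1 - #|P|))%N.
Proof.
(* [F i] collects the values allowed at [i]; [insub] tests [i \in P] and yields the index at which
   [g] is read. *)
pose F (i : 'I_n.-1) : pred bool :=
  if insub i is Some j then pred1 (g j) else predT.
have -> : #|[set x : swap n | restr P x == g]| = #|family F|.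
  apply: eq_card => x; rewrite inE; apply/eqP/familyP => [gE i|xF].
    by rewrite /F; case: insubP => [j _ <-|_] //; rewrite inE -gE ffunE.
  apply/ffunP => j; rewrite ffunE.
  by have := xF (val j); rewrite /F valK => /eqP.
rewrite card_family foldrE big_map big_enum /=.
rewrite (eq_bigr (fun i => if i \in ~: P then 2 else 1)%N) => [|i _].
  by rewrite -big_mkcond /= prod_nat_const cardsCs setCK card_ord.
rewrite /F inE; case: insubP => [j -> _|/negbTE ->] /=.
  exact: card1.
exact: card_bool.
Qed.

Theorem theorem18 (n k : nat) (hn : (3 <= n)%N) (hk : (2 <= k <= n.-1)%N)
    (e : 'I_(Tsize n k) -> kcontext n k) (he : bijective e)
    (s : 'I_(Tsize n k)) (N : cpt n) (hN : optimal (Tkn e) N) :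
  (f (Tkn e) (tnth (Tkn e) s))%:R >= (3%:R / 2%:R) * (f (Tkn e) N)%:R :> rat.
Proof.
(* Clearing the denominator leaves an inequality between natural numbers. *)
rewrite mulrAC ler_pdivrMr ?ltr0n // -!natrM ler_nat.
have [k2 kn] := andP hk.
have card_swap : #|swap n| = (2 ^ n.-1)%N by rewrite card_ffun card_bool card_ord.
have fN : (f (Tkn e) N <= 'C(n.-1, k) * 2 ^ n.-1)%N.
  apply: leq_trans (hN (@Cpt n set0 (fun=> Pref01))) _.
  by rewrite f_TknE // sum_nat_const card_swap mulnC.
rewrite tnth_Tkn; case: (e s) => P g /=; set Ns := single_cpt g.
have votes1 : #|vote Ns| = (2 ^ (n.-1 - k))%N.
  rewrite -[in RHS](eqP (valP P)) -(card_restr_fiber _ _ g).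
  by apply: eq_card => x; rewrite inE -vote_single_cpt.
have := cardC (vote Ns); rewrite votes1 card_swap.
have -> : f (Tkn e) Ns = (#|vote Ns| * ('C(n.-1, k) * (2 ^ k).-1)
                          + #|[predC vote Ns]| * 'C(n.-1, k))%N.
  by rewrite f_TknE // big_if /= !sum_nat_const.
rewrite votes1 -[X in _ = (2 ^ X)%N](subnK kn) expnD.
move: fN; rewrite -[X in (_ * 2 ^ X)%N](subnK kn) expnD.
set a := (2 ^ _)%N; set C := 'C(_, _); set v := #|_|.
have : (4 <= 2 ^ k)%N by rewrite (@leq_pexp2l 2 2 k).
set K := (2 ^ k)%N => K4 fN hv.
(* Of the [a * K] swaps, [a] get vote 1 and [v] get vote 0. Hence [f (Tkn e) Ns] equals
   [2 * a * C * (K - 1)], and [3 * C * a * K <= 4 * a * C * (K - 1)] follows from [4 <= K]. *)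
have -> : v = (a * K.-1)%N by nia.
case: K K4 fN {hv} => // K K4 fN /=.
by nia.
Qed.
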